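(* Let $n\ge 2$, $m\ge 1$. If the Heisenberg $n$-Lie algebra $H(n,m)$ is $2$-capable, then $m=1$.
   Context: An $n$-Lie algebra is a vector space $L$ over a field with a multilinear skew-symmetric operation $[x_1,\ldots,x_n]$ satisfying $[[x_1,\ldots,x_n],y_2,\ldots,y_n]=\sum_{i=1}^n[x_1,\ldots,[x_i,y_2,\ldots,y_n],\ldots,x_n]$. $L^2=[L,\dots,L]$ is the derived algebra (the subalgebra generated by all brackets), and the center is $Z(L)=\{z\in L: [z,L,\dots,L]=0\}$; the upper central series is $Z_0(L)=0$, $Z_1(L)=Z(L)$, $Z_i(L)/Z_{i-1}(L)=Z(L/Z_{i-1}(L))$. $L$ is $c$-capable if there is an $n$-Lie algebra $H$ with $L\cong H/Z_c(H)$. $L$ is Heisenberg if $L^2=Z(L)$ and $\dim L^2=1$; $H(n,m)$ denotes a Heisenberg $n$-Lie algebra of dimension $mn+1$. *)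

(* Defs.v *)
From HB Require Import structures.
From mathcomp Require Import all_boot all_algebra perm.
From mathcomp Require Import generic_quotient boolp.

Set Implicit Arguments.
Unset Strict Implicit.
Unset Printing Implicit Defensive.

Import GRing.Theory.
Local Open Scope ring_scope.
Local Open Scope quotient_scope.

(* The tuple x with its i-th entry replaced by u. *)
Definition upd (n : nat) (T : Type) (x : {ffun 'I_n -> T}) (i : 'I_n) (u : T) :
  {ffun 'I_n -> T} := [ffun j => if j == i then u else x j].

(* In [nLie_filippov], i0 is the first       *)
(* position, so that upd y i0 u is (u, y_2, ..., y_n) and the first entry of y *)
(* is irrelevant.                                                              *)
Record nLie (K : fieldType) (n : nat) (V : lmodType K) := NLie {
  nLie_bracket :> {ffun 'I_n -> V} -> V;
  nLie_multilinear : forall (x : {ffun 'I_n -> V}) (i : 'I_n),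
    linear (fun u : V => nLie_bracket (upd x i u));
  nLie_skew : forall (x : {ffun 'I_n -> V}) (s : 'S_n),
    nLie_bracket [ffun i => x (s i)] = (-1) ^+ s *: nLie_bracket x;
  nLie_filippov : forall (i0 : 'I_n) (x y : {ffun 'I_n -> V}),
    val i0 = 0%N ->
    nLie_bracket (upd y i0 (nLie_bracket x)) =
    \sum_(i < n) nLie_bracket (upd x i (nLie_bracket (upd y i0 (x i))))
}.

Definition nLie_iso (K : fieldType) (n : nat) (V W : lmodType K)
    (L : nLie n V) (M : nLie n W) : Prop :=
  exists f : {linear V -> W},
    bijective f /\
    forall x : {ffun 'I_n -> V}, f (L x) = M [ffun i => f (x i)].

Definition subalgebra (K : fieldType) (n : nat) (V : lmodType K)
    (L : nLie n V) (S : {pred V}) : Prop :=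
  submod_closed S /\
  forall x : {ffun 'I_n -> V}, (forall i, x i \in S) -> L x \in S.

(* L^2, the subalgebra generated by all brackets. *)
Definition derived (K : fieldType) (n : nat) (V : lmodType K)
    (L : nLie n V) : {pred V} :=
  fun x => `[< forall S : {pred V}, subalgebra L S ->
                 (forall y : {ffun 'I_n -> V}, L y \in S) -> x \in S >].

Definition center (K : fieldType) (n : nat) (V : lmodType K)
    (L : nLie n V) : {pred V} :=
  fun z => `[< forall (i0 : 'I_n) (x : {ffun 'I_n -> V}),
                 val i0 = 0%N -> L (upd x i0 z) = 0 >].

Record ideal (K : fieldType) (n : nat) (V : lmodType K)
    (L : nLie n V) := Ideal {
  ideal_pred :> {pred V};
  ideal_submod : submod_closed ideal_pred;
  ideal_closed : forall (x : {ffun 'I_n -> V}) (i : 'I_n),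
    x i \in ideal_pred -> L x \in ideal_pred
}.

HB.instance Definition _ (K : fieldType) (n : nat) (V : lmodType K)
    (L : nLie n V) (I : ideal L) :=
  GRing.isSubmodClosed.Build K V (ideal_pred I) (ideal_submod I).

Section QuotientModule.
Variables (K : fieldType) (n : nat) (V : lmodType K) (L : nLie n V).
Variable I : ideal L.

Definition quot := {ideal_quot (ideal_pred I)}.

HB.instance Definition _ : EqQuotient V (Quotient.equiv (ideal_pred I)) quot :=
  EqQuotient.on quot.
HB.instance Definition _ := GRing.Zmodule.on quot.

Definition proj (x : V) : quot := \pi_quot x.

Lemma proj_eq x y : (proj x == proj y) = (x - y \in I).
Proof. by rewrite Quotient.idealrBE. Qed.

Lemma proj_repr (q : quot) : proj (repr q) = q.
Proof. exact: reprK. Qed.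

Lemma projD x y : proj (x + y) = proj x + proj y.
Proof. exact: Quotient.pi_add. Qed.

Definition quot_scale (a : K) (q : quot) : quot := proj (a *: repr q).

Lemma proj_scale a x : quot_scale a (proj x) = proj (a *: x).
Proof.
by apply/eqP; rewrite proj_eq -scalerBr rpredZ // -proj_eq proj_repr.
Qed.

Lemma quot_scaleA a b q : quot_scale a (quot_scale b q) = quot_scale (a * b) q.
Proof. by rewrite -[q]proj_repr !proj_scale scalerA. Qed.

Lemma quot_scale1 : left_id 1 quot_scale.
Proof. by move=> q; rewrite -[q]proj_repr proj_scale scale1r. Qed.

Lemma quot_scaleDr : right_distributive quot_scale +%R.
Proof.
move=> a p q; rewrite -[p]proj_repr -[q]proj_repr !proj_scale.
by rewrite -!projD proj_scale scalerDr.
Qed.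

Lemma quot_scaleDl q : {morph quot_scale^~ q : a b / a + b}.
Proof.
by move=> a b; rewrite -[q]proj_repr !proj_scale -projD scalerDl.
Qed.

HB.instance Definition _ := GRing.Zmodule_isLmodule.Build K quot
  quot_scaleA quot_scale1 quot_scaleDr quot_scaleDl.

Lemma proj_linear : linear proj.
Proof. by move=> a x y; rewrite projD -proj_scale. Qed.

HB.instance Definition _ := GRing.isLinear.Build K V quot _ proj proj_linear.

End QuotientModule.

Section Quotient.
Variables (K : fieldType) (n : nat) (V : lmodType K) (L : nLie n V).
Variable I : ideal L.
Implicit Types x y : {ffun 'I_n -> V}.

Lemma upd_id x i : upd x i (x i) = x.
Proof. by apply/ffunP=> j; rewrite ffunE; case: eqP => [->|]. Qed.

Lemma nLie_updB x i u v : L (upd x i u) - L (upd x i v) = L (upd x i (u - v)).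
Proof.
have /(_ (-1) v u) := nLie_multilinear L x i.
by rewrite !scaleN1r addrC [- v + u]addrC => <-.
Qed.

Lemma bracket_equiv x y :
  (forall i, x i - y i \in I) -> L x - L y \in I.
Proof.
move=> xyI.
pose h k : {ffun 'I_n -> V} := [ffun j : 'I_n => if (j < k)%N then x j else y j].
have hI k : (k <= n)%N -> L (h k) - L y \in I.
  elim: k => [_|k IHk lt_kn].
    rewrite (_ : h 0%N = y) ?subrr ?rpred0 //.
    by apply/ffunP=> j; rewrite ffunE ltn0.
  rewrite -(subrK (L (h k)) (L (h k.+1))) -addrA rpredD ?IHk ?(ltnW lt_kn) //.
  pose i := Ordinal lt_kn.
  have -> : h k.+1 = upd (h k) i (x i).
    apply/ffunP=> j; rewrite !ffunE ltnS leq_eqVlt -[X in (j == X :> nat)]/(val i).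
    by rewrite -val_eqE; case: eqVneq => [/val_inj->|].
  rewrite -[X in _ - L X](upd_id _ i) nLie_updB.
  by apply: (@ideal_closed _ _ _ _ I _ i); rewrite !ffunE eqxx ltnn.
have := hI n (leqnn n); rewrite (_ : h n = x) //.
by apply/ffunP=> j; rewrite ffunE ltn_ord.
Qed.

Definition quot_bracket (q : {ffun 'I_n -> quot I}) : quot I :=
  proj I (L [ffun i => repr (q i)]).

Lemma quot_bracketE x :
  quot_bracket [ffun i => proj I (x i)] = proj I (L x).
Proof.
apply/eqP; rewrite proj_eq bracket_equiv // => i.
by rewrite !ffunE -proj_eq proj_repr.
Qed.

Lemma quot_lift (q : {ffun 'I_n -> quot I}) :
  exists x, q = [ffun i => proj I (x i)].
Proof.
by exists [ffun i => repr (q i)]; apply/ffunP=> i; rewrite !ffunE proj_repr.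
Qed.

Lemma upd_pi x i u :
  upd [ffun i => proj I (x i)] i (proj I u) =
  [ffun j => proj I (upd x i u j)].
Proof. by apply/ffunP=> j; rewrite !ffunE; case: eqP. Qed.

Lemma quot_multilinear (q : {ffun 'I_n -> quot I}) (i : 'I_n) :
  linear (fun u => quot_bracket (upd q i u)).
Proof.
have [x ->] := quot_lift q; move=> a u v; rewrite -[u]proj_repr -[v]proj_repr -linearP !upd_pi.
by rewrite !quot_bracketE nLie_multilinear linearP.
Qed.

Lemma quot_skew (q : {ffun 'I_n -> quot I}) (s : 'S_n) :
  quot_bracket [ffun i => q (s i)] = (-1) ^+ s *: quot_bracket q.
Proof.
have [x ->] := quot_lift q.
rewrite quot_bracketE -linearZ /= -nLie_skew -quot_bracketE; congr quot_bracket.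
by apply/ffunP=> i; rewrite !ffunE.
Qed.

Lemma quot_filippov (i0 : 'I_n) (p q : {ffun 'I_n -> quot I}) :
  val i0 = 0%N ->
  quot_bracket (upd q i0 (quot_bracket p)) =
  \sum_(i < n) quot_bracket (upd p i (quot_bracket (upd q i0 (p i)))).
Proof.
move=> i0E; have [y ->] := quot_lift q.
have [x ->] := quot_lift p.
rewrite quot_bracketE upd_pi quot_bracketE nLie_filippov // linear_sum.
apply: eq_bigr => i _.
have -> : [ffun j => proj I (x j)] i = proj I (x i) by rewrite ffunE.
by rewrite !(upd_pi, quot_bracketE).
Qed.

Definition nLie_quot : nLie n (quot I) :=
  NLie quot_multilinear quot_skew quot_filippov.

End Quotient.

Section Ideals.
Variables (K : fieldType) (n : nat) (V : lmodType K) (L : nLie n V).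

Lemma center_submod : submod_closed (center L).
Proof.
split=> [|a u v /asboolP uZ /asboolP vZ]; apply/asboolP => i0 x i0E.
  have := nLie_updB L x i0 0 0.
  by rewrite !subrr => <-.
by rewrite nLie_multilinear uZ // vZ // scaler0 addr0.
Qed.

Lemma center_closed (x : {ffun 'I_n -> V}) (i : 'I_n) :
  x i \in center L -> L x \in center L.
Proof.
move=> /asboolP xiZ; suff -> : L x = 0 by have [] := center_submod.
have n_gt0 : (0 < n)%N by apply: leq_ltn_trans (ltn_ord i).
pose i0 := Ordinal n_gt0; pose s := tperm i0 i.
have := nLie_skew L x s.
have -> : [ffun j => x (s j)] = upd [ffun j => x (s j)] i0 (x i).
  by apply/ffunP=> j; rewrite !ffunE; case: eqP => // ->; rewrite tpermL.
by rewrite xiZ // => /esym/eqP; rewrite scaler_eq0 signr_eq0 => /eqP.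
Qed.

Definition center_ideal : ideal L := Ideal center_submod center_closed.

Definition zero_pred : {pred V} := pred1 0.

Lemma zero_submod : submod_closed zero_pred.
Proof.
by split=> [|a u v /eqP-> /eqP->]; rewrite inE ?scaler0 ?addr0.
Qed.

Lemma zero_closed (x : {ffun 'I_n -> V}) (i : 'I_n) :
  x i \in zero_pred -> L x \in zero_pred.
Proof.
move=> /eqP xi0; rewrite -(upd_id x i) xi0 -(subrr 0) -nLie_updB subrr.
exact: eqxx.
Qed.

Definition zero_ideal : ideal L := Ideal zero_submod zero_closed.

Section Preimage.
Variables (I : ideal L) (J : ideal (nLie_quot I)).

Definition preim_pred : {pred V} := fun x => proj I x \in J.

Lemma preim_pred_submod : submod_closed preim_pred.
Proof.
split=> [|a u v uJ vJ]; rewrite unfold_in; first by rewrite linear0 rpred0.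
by rewrite linearP rpredD ?rpredZ.
Qed.

Lemma preim_pred_closed (x : {ffun 'I_n -> V}) (i : 'I_n) :
  x i \in preim_pred -> L x \in preim_pred.
Proof.
move=> xiJ; rewrite unfold_in -quot_bracketE.
by apply: (@ideal_closed _ _ _ _ J _ i); rewrite ffunE.
Qed.

Definition preim_ideal : ideal L := Ideal preim_pred_submod preim_pred_closed.
End Preimage.

End Ideals.

(* Z_c(L); Z_(c+1)(L) is the preimage of Z(L / Z_c(L)) in L. *)
Fixpoint upper_central (K : fieldType) (n : nat) (V : lmodType K)
    (L : nLie n V) (c : nat) : ideal L :=
  if c is c'.+1 then
    preim_ideal (center_ideal (nLie_quot (upper_central L c')))
  else zero_ideal L.

Definition capable (K : fieldType) (n : nat) (V : lmodType K) (c : nat)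
    (L : nLie n V) : Prop :=
  exists (W : lmodType K) (H : nLie n W),
    nLie_iso L (nLie_quot (upper_central H c)).

Definition Heisenberg (K : fieldType) (n : nat) (V : vectType K)
    (L : nLie n V) : Prop :=
  derived L =i center L /\
  exists2 U : {vspace V}, U =i derived L & \dim U = 1%N.

(* L is an H(n, m). *)
Definition Heisenberg_nm (K : fieldType) (n m : nat) (V : vectType K)
    (L : nLie n V) : Prop :=
  Heisenberg L /\ \dim {: V} = (m * n + 1)%N.

(* Main.v *)
From HB Require Import structures.
Require Import Defs.
From mathcomp Require Import all_boot all_order all_algebra.
From mathcomp Require Import perm boolp.

(** If [L] is [2]-capable, then [L = G / Z(G)] for [G = H / Z_1(H)]
([capable_central_cover]).  Write [L x = omega(x) z], where [z] spans the line
[L^2 = Z(L)], and lift [z] to [G], where it is no longer central.  The bracket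
of [G] is then [omega(x) z] up to a central term, so the Filippov identity in
[G] reads

  [omega(x) [z, y_2, .., y_n] =
     sum_i omega(x_i, y_2, .., y_n) [x_1, .., z, .., x_n]]

with [z] in position [i] on the right ([filippov_form]).  This says that
[omega] is, up to a nonzero vector [v = [z, y_2, .., y_n]], the product
[beta /\ phi] of the linear form [beta(u) = omega(u, y_2, .., y_n)] and the
skew form [phi(x_2, .., x_n) = [z, x_2, .., x_n]].  As [beta /\ beta = 0], the
product [beta /\ omega] vanishes ([wedge_form_eq0]).  It vanishes for all
contractions [beta] of [omega], because one with [v = 0] is the difference of two
linear forms for which [v] is the same nonzero vector.  These are the Pluecker relations
([plucker_relation]), which say that [omega] is decomposable.

Explicitly, fix [x] with [omega(x) <> 0].  By the Pluecker relations, a vector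
[u] such that replacing any one entry of [x] by [u] gives a tuple killed by
[omega] is killed by every contraction of [omega], hence is central in [L]
([bracket_null]).  So [n] linear equations define a subspace of the line
[Z(L)], whence [dim L <= n + 1] ([dim_Heisenberg_cover]); since
[dim L = m n + 1], this leaves only [m = 1].

The argument is uniform in the characteristic: in characteristic [2], where
skew-symmetric forms need not be alternating, the square of a linear form still
vanishes because its terms cancel in pairs ([big_antisym]). *)

Set Implicit Arguments.
Unset Strict Implicit.
Unset Printing Implicit Defensive.

Import GRing.Theory.
Local Open Scope ring_scope.

(** * Brackets and the centre *)

Section Bracket.
Variables (K : fieldType) (n : nat) (V : lmodType K) (L : nLie n V).
Implicit Types x y : {ffun 'I_n -> V}.

Lemma upd_swap x (i j : 'I_n) (u v : V) : i != j ->
  L (upd (upd x j u) i v) = - L (upd (upd x i u) j v).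
Proof.
move=> neq_ij; have := nLie_skew L (upd (upd x i u) j v) (tperm i j).
rewrite odd_tperm neq_ij expr1 scaleN1r => <-; congr (L _).
apply/ffunP=> k; rewrite !ffunE; case: tpermP => [->|->|/eqP ki /eqP kj].
- by rewrite !eqxx.
- by rewrite !eqxx eq_sym (negPf neq_ij).
by rewrite (negPf ki) (negPf kj).
Qed.

Lemma upd_twice x (i : 'I_n) (u v : V) : upd (upd x i u) i v = upd x i v.
Proof. by apply/ffunP=> j; rewrite !ffunE; case: eqP. Qed.

(** The centre is defined through the first position; skew-symmetry moves a
central entry there from any other position. *)
Lemma center_anywhere x (i : 'I_n) (c : V) : c \in center L -> L (upd x i c) = 0.
Proof.
move=> /asboolP cZ.
pose i0 : 'I_n := Ordinal (leq_ltn_trans (leq0n i) (ltn_ord i)).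
pose s := tperm i0 i.
have := nLie_skew L (upd x i c) s.
have -> : [ffun j => upd x i c (s j)] = upd [ffun j => x (s j)] i0 c.
  apply/ffunP=> j; rewrite !ffunE; congr (if _ then _ else _).
  by rewrite -(inj_eq (@perm_inj _ s) j) tpermL.
by rewrite cZ // => /esym/eqP; rewrite scaler_eq0 signr_eq0 => /eqP.
Qed.

Lemma bracket_updZ x (i : 'I_n) a (u c : V) :
  u - a *: c \in center L -> L (upd x i u) = a *: L (upd x i c).
Proof.
move=> uZ; rewrite -[u](subrK (a *: c)) addrC.
by rewrite nLie_multilinear (center_anywhere _ _ uZ) addr0.
Qed.

End Bracket.

(** The terms at [(i, j)] and [(j, i)] cancel, and the diagonal is left out, so
that [2] need not be invertible. *)
Lemma big_antisym (W : zmodType) (n : nat) (F : 'I_n -> 'I_n -> W) :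
  (forall i j, i != j -> F j i = - F i j) ->
  \sum_i \sum_(j | j != i) F i j = 0.
Proof.
move=> F_anti.
have split_sum i : \sum_(j | j != i) F i j =
    \sum_(j < n | (i < j)%N) F i j + \sum_(j < n | (j < i)%N) F i j.
  rewrite (bigID (fun j : 'I_n => (i < j)%N)) /=.
  by congr (_ + _); apply: eq_bigl => j; rewrite -val_eqE /=; case: ltngtP.
under eq_bigr => i _ do rewrite split_sum.
rewrite big_split /= [X in _ + X](exchange_big_dep predT) //= -big_split /=.
rewrite big1 // => i _; rewrite -big_split big1 //= => j lt_ij.
by rewrite [F j i]F_anti ?subrr // -val_eqE /= neq_ltn lt_ij.
Qed.

(** * Decomposability of a bracket whose values lie on a line modulo the centre *)

Section LineModCenter.
Variables (K : fieldType) (n : nat) (W : lmodType K) (G : nLie n W).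
Variables (z : W) (kappa : W -> K).
Hypothesis bracketZ : forall x, G x - kappa (G x) *: z \in center G.
Variable i0 : 'I_n.
Hypothesis i0E : val i0 = 0%N.
Implicit Types x y : {ffun 'I_n -> W}.

(** Only the part [kappa (G _) *: z] of an inner bracket contributes to the outer
one, so the Filippov identity becomes an identity between the scalar form
[kappa \o G] and the vector-valued form obtained by inserting [z]. *)
Lemma filippov_form x y :
  kappa (G x) *: G (upd y i0 z) =
  \sum_i kappa (G (upd y i0 (x i))) *: G (upd x i z).
Proof.
rewrite -(bracket_updZ _ _ (bracketZ x)) nLie_filippov //.
by apply: eq_bigr => i _; rewrite (bracket_updZ _ _ (bracketZ _)).
Qed.

(** With [omega = kappa \o G], the hypothesis says [omega v = beta /\ phi], and
the conclusion says [beta /\ omega = 0], evaluated at the [n + 1] vectors [u] and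
[x].  After multiplication by [v] it is [beta /\ beta /\ phi = 0]. *)
Lemma wedge_form_eq0 (beta : W -> K) (v : W) : v != 0 ->
    (forall x, kappa (G x) *: v = \sum_i beta (x i) *: G (upd x i z)) ->
  forall u x, beta u * kappa (G x) = \sum_i beta (x i) * kappa (G (upd x i u)).
Proof.
move=> v_neq0 factor u x; apply/eqP; rewrite -subr_eq0.
suff : (beta u * kappa (G x) -
        \sum_i beta (x i) * kappa (G (upd x i u))) *: v == 0.
  by rewrite scaler_eq0 (negPf v_neq0) orbF.
rewrite scalerBl subr_eq0 -scalerA factor scaler_suml scaler_sumr.
(* The term [j = i] of the second expansion is the one in which [u] has been
   overwritten by [z]: these terms add up to the left-hand side, and the others
   are antisymmetric in [i] and [j]. *)
have expand i : (beta (x i) * kappa (G (upd x i u))) *: v =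
    beta u *: (beta (x i) *: G (upd x i z)) +
    \sum_(j | j != i) (beta (x i) * beta (x j)) *: G (upd (upd x i u) j z).
  rewrite -scalerA factor (bigD1 i) //= scalerDr upd_twice ffunE eqxx.
  rewrite !scalerA [_ * beta u]mulrC scaler_sumr; congr (_ + _).
  by apply: eq_bigr => j neq_ji; rewrite scalerA ffunE (negPf neq_ji).
under [X in _ == X]eq_bigr => i _ do rewrite expand.
rewrite big_split /= [X in _ == _ + X]big_antisym ?addr0 // => i j neq_ij.
by rewrite upd_swap // scalerN mulrC.
Qed.

(** Every linear form [omega(_, y_2, .., y_n)] annihilates [omega]. *)
Lemma plucker_relation : z \notin center G -> forall y u x,
  kappa (G (upd y i0 u)) * kappa (G x) =
  \sum_i kappa (G (upd y i0 (x i))) * kappa (G (upd x i u)).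
Proof.
move=> zNZ y u x.
have [y0 y0z] : exists y0, G (upd y0 i0 z) != 0.
  apply: contrapT => noy; case/negP: zNZ; apply/asboolP => i x' iE.
  apply/eqP; apply: contrapT => /negP ?; case: noy; exists x'.
  by rewrite (_ : i0 = i) //; apply: val_inj; rewrite iE.
pose alpha y' w := kappa (G (upd y' i0 w)).
have plucker0 := wedge_form_eq0 (beta := alpha y0) y0z (filippov_form^~ y0).
(* If [G (upd y i0 z) = 0], then [alpha y0 + alpha y] gives a factorization of
   [omega] with the same nonzero vector as [alpha y0], and the relation for
   [alpha y] follows by subtraction. *)
have [yz|yz] := eqVneq (G (upd y i0 z)) 0; last first.
  exact: (wedge_form_eq0 (beta := alpha y) yz (filippov_form^~ y)).
pose beta w := alpha y0 w + alpha y w.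
have factor x' : kappa (G x') *: G (upd y0 i0 z) =
    \sum_i beta (x' i) *: G (upd x' i z).
  under eq_bigr => i _ do rewrite scalerDl.
  by rewrite big_split /= -!filippov_form yz scaler0 addr0.
have := wedge_form_eq0 (beta := beta) y0z factor u x.
rewrite mulrDl plucker0.
under [RHS]eq_bigr => i _ do rewrite mulrDl.
by rewrite big_split /=; apply: addrI.
Qed.

(** The Pluecker relation, divided by the nonzero [omega(x)], writes every
contraction of [omega] at [u] as a combination of the [n] values of [omega] at
the tuples obtained from [x] by inserting [u]. *)
Lemma bracket_null x u : z \notin center G -> kappa (G x) != 0 ->
    (forall i, kappa (G (upd x i u)) = 0) ->
  forall y, kappa (G (upd y i0 u)) = 0.
Proof.
move=> zNZ x_neq0 u0 y; have := plucker_relation zNZ y u x.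
rewrite big1 => [/eqP|i _]; last by rewrite u0 mulr0.
by rewrite mulf_eq0 (negPf x_neq0) orbF => /eqP.
Qed.

End LineModCenter.

(** * Capability and the dimension bound *)

(** The extension is [G = H / Z_c(H)]: as [Z_(c+1)(H)] is the preimage of [Z(G)],
the projection of [H] onto [H / Z_(c+1)(H)] factors through [G] with kernel
[Z(G)].  The section [s] serves to lift vectors without further choices. *)
Lemma capable_central_cover (K : fieldType) (n c : nat) (V : lmodType K)
    (L : nLie n V) : capable c.+1 L ->
  exists (W : lmodType K) (G : nLie n W) (p : {linear W -> V}) (s : V -> W),
    [/\ cancel s p,
        forall x : {ffun 'I_n -> W}, p (G x) = L [ffun i => p (x i)] &
        forall w, (p w == 0) = (w \in center G)].
Proof.
case=> W [H [f [[g fK gK] fM]]].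
pose I := upper_central H c; pose J := upper_central H c.+1.
pose p (q : quot I) : V := g (proj J (repr q)).
have memJ w : (w \in J) = (proj I w \in center (nLie_quot I)) by [].
have projJ w : p (proj I w) = g (proj J w).
  congr g; apply/eqP; rewrite proj_eq memJ linearB /= proj_repr subrr.
  by have [] := center_submod (nLie_quot I).
have g_lin : linear g by move=> a u v; apply: (can_inj fK); rewrite linearP !gK.
have p_lin : linear p.
  move=> a u v; rewrite -[u]proj_repr -[v]proj_repr -linearP !projJ.
  by rewrite linearP g_lin.
pose pL : {linear quot I -> V} := HB.pack p (GRing.isLinear.Build _ _ _ _ p p_lin).
exists (quot I), (nLie_quot I), pL, (fun v => proj I (repr (f v))); split.
- by move=> v; rewrite /= projJ proj_repr fK.
- move=> q; have [x ->] := quot_lift q.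
  rewrite /= quot_bracketE projJ; apply: (can_inj fK).
  rewrite gK fM -quot_bracketE; congr quot_bracket.
  by apply/ffunP=> i; rewrite !ffunE projJ gK.
move=> q; rewrite -[q]proj_repr /= projJ.
have -> : (g (proj J (repr q)) == 0) = (proj J (repr q) == proj J 0).
  rewrite linear0 -(inj_eq (can_inj fK)) gK [f 0]linear0 //.
by rewrite proj_eq subr0 memJ.
Qed.

Lemma Heisenberg_line (K : fieldType) (n : nat) (V : vectType K) (L : nLie n V) :
  Heisenberg L -> exists z : V,
  [/\ z != 0, forall v, (v \in <[z]>%VS) = (v \in center L),
      forall x, L x \in <[z]>%VS & exists x, L x != 0].
Proof.
case=> dLZ [U UdL dimU]; pose z := vpick U.
have z_neq0 : z != 0 by rewrite vpick0 -dimv_eq0 dimU.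
have UE : U = <[z]>%VS.
  apply/esym/eqP; rewrite eqEdim -memvE memv_pick dimU dim_vline z_neq0 //.
have Ld x : L x \in derived L by apply/asboolP => S _; apply.
exists z; split=> // [v|x|]; rewrite -?UE ?UdL ?dLZ //; first by rewrite -dLZ.
(* The bracket cannot vanish identically: the zero subspace would then be a
   subalgebra containing all brackets. *)
apply: contrapT => L0; case/negP: z_neq0.
have : z \in derived L by rewrite -UdL memv_pick.
have Lx0 x : L x = 0 by apply/eqP; apply: contrapT => /negP Lx; case: L0; exists x.
move=> /asboolP/(_ (pred1 0)); apply=> [|x]; last by rewrite Lx0 inE.
by split=> [|x _]; [exact: zero_submod | rewrite Lx0 inE].
Qed.

(** The forms [h i] together give a map to [K^n] whose kernel lies in [U]. *)
Lemma dim_common_kernel (K : fieldType) (n : nat) (V : vectType K)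
    (h : 'I_n -> V -> K) (U : {vspace V}) :
    (forall i, scalar (h i)) -> (forall u, (forall i, h i u = 0) -> u \in U) ->
  (\dim {:V} <= \dim U + n)%N.
Proof.
move=> h_lin hU; pose H u : 'rV[K]_n := \row_i h i u.
have H_lin : linear H.
  by move=> a u v; apply/rowP=> i; rewrite !mxE h_lin.
pose HL : {linear V -> 'rV[K]_n} :=
  HB.pack H (GRing.isLinear.Build _ _ _ _ H H_lin).
rewrite -(limg_ker_dim (linfun HL) fullv) capfv leq_add //; last first.
  by rewrite (leq_trans (dimvS (subvf _))) // dimvf /dim /= mul1n.
apply/dimvS/subvP=> u; rewrite memv_ker lfunE /= => /eqP Hu0.
by apply: hU => i; have /rowP/(_ i) := Hu0; rewrite !mxE.
Qed.

(** Fixing [x] with [L x <> 0], the [n] equations saying that the bracket vanishes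
when [u] replaces an entry of [x] force [u] into the line [Z(L)].  The
relations used are those of the lifts of [x] and [u] to [G]. *)
Lemma dim_Heisenberg_cover (K : fieldType) (n : nat) (V : vectType K)
    (L : nLie n V) (W : lmodType K) (G : nLie n W)
    (p : {linear W -> V}) (s : V -> W) : (0 < n)%N -> Heisenberg L ->
    cancel s p -> (forall x : {ffun 'I_n -> W}, p (G x) = L [ffun i => p (x i)]) ->
    (forall w, (p w == 0) = (w \in center G)) ->
  (\dim {:V} <= n.+1)%N.
Proof.
move=> n_gt0 /Heisenberg_line[z [z_neq0 zZ Lz [x Lx_neq0]]] sK pG kerp.
pose i0 := Ordinal n_gt0.
pose kappaV : V -> K := coord [tuple z] ord0.
have kappaVE v : v \in <[z]>%VS -> v = kappaV v *: z.
  by rewrite -span_seq1 => /coord_span {1}->; rewrite big_ord1.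
pose kappa w := kappaV (p w).
have bracketZ X : G X - kappa (G X) *: s z \in center G.
  rewrite -kerp linearB linearZ /= sK subr_eq0 /kappa.
  by rewrite -kappaVE // pG.
have zNZ : s z \notin center G by rewrite -kerp sK.
pose lift (y : {ffun 'I_n -> V}) : {ffun 'I_n -> W} := [ffun i => s (y i)].
have p_lift y : p (G (lift y)) = L y.
  by rewrite pG; congr (L _); apply/ffunP=> i; rewrite !ffunE sK.
have lift_upd y i u : lift (upd y i u) = upd (lift y) i (s u).
  by apply/ffunP=> j; rewrite !ffunE; case: eqP.
have kappa_upd y i u : kappa (G (upd (lift y) i (s u))) = kappaV (L (upd y i u)).
  by rewrite -lift_upd /kappa p_lift.
have x_neq0 : kappa (G (lift x)) != 0.
  rewrite /kappa p_lift; apply: contraNneq Lx_neq0 => Lx0.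
  by rewrite [L x]kappaVE // Lx0 scale0r.
rewrite -addn1 addnC -[1%N](_ : \dim <[z]> = 1%N); last by rewrite dim_vline z_neq0.
apply: (dim_common_kernel (h := fun i u => kappaV (L (upd x i u)))) => [i|u u0].
  by move=> a u v; rewrite nLie_multilinear /kappaV linearP.
rewrite zZ; apply/asboolP=> i y iE.
have {i iE}-> : i = i0 by apply: val_inj; rewrite iE.
rewrite [LHS]kappaVE // -kappa_upd.
rewrite (bracket_null bracketZ _ zNZ x_neq0) ?scale0r // => j.
by rewrite kappa_upd u0.
Qed.

Local Close Scope ring_scope.

Theorem theorem3p3 (K : fieldType) (n m : nat) (V : vectType K) (L : nLie n V) :
  2 <= n -> 1 <= m -> Heisenberg_nm m L -> capable 2 L -> m = 1.
Proof.
move=> n_gt1 m_gt0 [heisL dimL] /capable_central_cover[W [G [p [s [sK pG kerp]]]]].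
have := dim_Heisenberg_cover (ltnW n_gt1) heisL sK pG kerp.
rewrite dimL addn1 ltnS -[X in _ <= X]mul1n leq_pmul2r ?(ltnW n_gt1) // => m_le1.
by apply/eqP; rewrite eqn_leq m_le1.
Qed.
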